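(* Let $s$ be a single BIPASS strip and let $k\ge 0$ be an integer. Then (a) $s\equiv k\cdot(\uparrow+* )+*$ if and only if there is an integer $n\ge 0$ such that $s=BW^{n+k}B^{n}W$ (the strip consisting of one black stone, then $n+k$ white stones, then $n$ black stones, then one white stone); (b) $s\equiv k\cdot(\downarrow+* )+*$ if and only if there is an integer $n\ge 0$ such that $s=BW^{n}B^{n+k}W$.
   Context: **BIPASS.** A strip is a finite word over $\{B,W\}$ ($B$ = black stone, $W$ = white stone). Dead stones are removed immediately: a white stone with no black stone to its left, and a black stone with no white stone to its right, are deleted. So a strip is either the empty word (the game $0$) or a word beginning with $B$ and ending with $W$. A Left move chooses a black stone at position $i$ and a white stone at position $j>i$ with no black stone strictly between them, and interchanges the two; a Right move chooses a black stone at position $i$ and a white stone at position $j>i$ with no white stone strictly between them, and interchanges the two. After a move, dead stones (all leading $W$'s and all trailing $B$'s) are deleted. Normal play: a player who cannot move loses. $G\equiv H$ denotes equality of normal-play game values (i.e. $G-H$ is a second-player win). $*=\{0\mid 0\}$, $\uparrow=\{0\mid *\}$, $\downarrow=\{*\mid 0\}=-\uparrow$, and $k\cdot G$ is the disjunctive sum of $k$ copies of $G$ ($0\cdot G=0$). The equality $s=\dots$ is literal equality of strips. *)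

(* Defs.v *)
From HB Require Import structures.
From mathcomp Require Import all_boot.
From mathcomp Require Import zify.

Set Implicit Arguments.
Unset Strict Implicit.
Unset Printing Implicit Defensive.

(* Short games under normal play, as finite trees listing the Left options
   and the Right options. *)
Inductive game : Type := Game of seq game & seq game.

Declare Scope game_scope.
Delimit Scope game_scope with game.
Bind Scope game_scope with game.

Fixpoint oppg (G : game) : game :=
  let: Game GL GR := G in Game (map oppg GR) (map oppg GL).

Fixpoint addg (G : game) : game -> game :=
  let: Game GL GR := G in
  fix addG (H : game) : game :=
    let: Game HL HR := H in
    Game ([seq addg G' H | G' <- GL] ++ [seq addG H' | H' <- HL])
         ([seq addg G' H | G' <- GR] ++ [seq addG H' | H' <- HR]).

Notation "- G" := (oppg G) : game_scope.
Notation "G + H" := (addg G H) : game_scope.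
Notation "G - H" := (addg G (oppg H)) : game_scope.

Inductive player : Type := Left | Right.

(* [wins_first p G]: player [p], moving first in [G], has a winning strategy. *)
Fixpoint wins_first (p : player) (G : game) : bool :=
  let: Game GL GR := G in
  match p with
  | Left => has (fun G' => ~~ wins_first Right G') GL
  | Right => has (fun G' => ~~ wins_first Left G') GR
  end.

Definition second_player_win (G : game) : bool :=
  ~~ wins_first Left G && ~~ wins_first Right G.

Definition eqg (G H : game) : bool := second_player_win (G - H)%game.

Notation "G ≡ H" := (eqg G H) (at level 70, no associativity) : game_scope.

Definition zerog : game := Game [::] [::].
Definition star : game := Game [:: zerog] [:: zerog].
Definition up : game := Game [:: zerog] [:: star].
Definition down : game := Game [:: star] [:: zerog].

Definition copies (k : nat) (G : game) : game := iter k (addg G) zerog.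

Notation "k ⋅ G" := (copies k%N G) (at level 40, left associativity) :
  game_scope.

Inductive stone : Type := B | W.

Definition is_black (c : stone) : bool := if c is B then true else false.
Definition stone_of_bool (b : bool) : stone := if b then B else W.
Lemma is_blackK : cancel is_black stone_of_bool. Proof. by case. Qed.
HB.instance Definition _ := Equality.copy stone (can_type is_blackK).

Definition is_strip (s : seq stone) : bool :=
  (s == [::]) || (head W s == B) && (last B s == W).

Fixpoint strip_leading (c : stone) (s : seq stone) : seq stone :=
  if s is c' :: s' then if c' == c then strip_leading c s' else s else [::].

Definition remove_dead (s : seq stone) : seq stone :=
  rev (strip_leading B (rev (strip_leading W s))).

(* Stones strictly between positions [i] and [j], for [i < j]. *)
Definition between (i j : nat) (s : seq stone) : seq stone :=
  take (j - i.+1) (drop i.+1 s).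

(* [jump c s i j]: positions [i < j] hold a black and a white stone
   respectively, with no stone of colour [c] strictly between them.  The
   default values of [nth] make the test fail beyond the end of [s]. *)
Definition jump (c : stone) (s : seq stone) (i j : nat) : bool :=
  [&& i < j, nth W s i == B, nth B s j == W & c \notin between i j s].

Definition interchange (s : seq stone) (i j : nat) : seq stone :=
  set_nth B (set_nth B s i W) j B.

Definition moves (c : stone) (s : seq stone) : seq (seq stone) :=
  [seq remove_dead (interchange s ij.1 ij.2)
     | ij <- [seq (i, j) | i <- iota 0 (size s), j <- iota 0 (size s)]
     & jump c s ij.1 ij.2].

Definition left_moves : seq stone -> seq (seq stone) := moves B.
Definition right_moves : seq stone -> seq (seq stone) := moves W.

(* Number of pairs formed by a black stone and a white stone to its right;
   it decreases strictly with every move. *)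
Fixpoint inversions (s : seq stone) : nat :=
  if s is c :: s' then
    (if c == B then count_mem W s' else 0) + inversions s'
  else 0.

Fixpoint bipass_rec (fuel : nat) (s : seq stone) : game :=
  if fuel is fuel'.+1 then
    Game (map (bipass_rec fuel') (left_moves s))
         (map (bipass_rec fuel') (right_moves s))
  else zerog.

(* The game tree of a position; by [bipassE] below the fuel never runs out. *)
Definition bipass (s : seq stone) : game := bipass_rec (inversions s) s.

Lemma inversions_cat (s t : seq stone) :
  inversions (s ++ t)
  = inversions s + inversions t + count_mem B s * count_mem W t.
Proof.
elim: s => [|c s IHs] /=; first by rewrite mul0n addn0.
by rewrite IHs count_cat; case: c => /=; lia.
Qed.

Lemma inversions_strip_leading_W (s : seq stone) :
  inversions (strip_leading W s) = inversions s.
Proof. by elim: s => //= -[]. Qed.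

Lemma inversions_strip_trailing_B (s : seq stone) :
  inversions (rev (strip_leading B (rev s))) = inversions s.
Proof.
elim/last_ind: s => // s c IHs; rewrite rev_rcons /=.
case: c => /=; last by rewrite rev_cons revK.
by rewrite IHs -cats1 inversions_cat /= muln0 !addn0.
Qed.

Lemma inversions_remove_dead (s : seq stone) :
  inversions (remove_dead s) = inversions s.
Proof.
by rewrite /remove_dead inversions_strip_trailing_B inversions_strip_leading_W.
Qed.

Lemma inversions_interchange (c : stone) (s : seq stone) (i j : nat) :
  jump c s i j -> inversions (interchange s i j) < inversions s.
Proof.
case/and4P=> ltij /eqP si /eqP sj _.
have ltjs : j < size s.
  by rewrite ltnNge; apply/negP=> /(nth_default B); rewrite sj.
have ltis : i < size s := ltn_trans ltij ltjs.
pose m := between i j s; pose b := drop j.+1 s.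
have szi : size (take i s) = i by rewrite size_takel // ltnW.
have def_s : s = take i s ++ B :: m ++ W :: b.
  rewrite -{1}(cat_take_drop i s) (drop_nth W ltis) si; congr (_ ++ _ :: _).
  rewrite -{1}(cat_take_drop (j - i.+1) (drop i.+1 s)) drop_drop subnK //.
  by rewrite (drop_nth B ltjs) sj.
have szm : size m = j - i.+1.
  by rewrite size_takel // size_drop leq_sub2r // ltnW.
have -> : interchange s i j = take i s ++ W :: m ++ B :: b.
  rewrite /interchange [in LHS]def_s.
  set a := take i s in szi *.
  have -> : set_nth B (a ++ B :: m ++ W :: b) i W = a ++ W :: m ++ W :: b.
    by rewrite -szi; elim: (a) => //= x a' ->.
  have -> : j = size (a ++ W :: m) by rewrite size_cat /= szi szm; lia.
  rewrite -[a ++ W :: m ++ B :: b]/(a ++ (W :: m) ++ B :: b) catA.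
  rewrite -[a ++ W :: m ++ W :: b]/(a ++ (W :: m) ++ W :: b) catA.
  by elim: (a ++ _) => //= x a' ->.
rewrite [X in _ < inversions X]def_s !(inversions_cat, count_cat) /=.
rewrite !(inversions_cat, count_cat) /=; nia.
Qed.

Lemma inversions_moves (c : stone) (s t : seq stone) :
  t \in moves c s -> inversions t < inversions s.
Proof.
case/mapP=> -[i j] /=; rewrite mem_filter => /andP[jmp _] ->.
by rewrite inversions_remove_dead (inversions_interchange jmp).
Qed.

Lemma bipass_rec_fuel (n : nat) (s : seq stone) :
  inversions s <= n -> bipass_rec n s = bipass s.
Proof.
have moves0 c t : inversions t = 0 -> moves c t = [::].
  move=> t0; case E: (moves c t) => [//|u l].
  by have := @inversions_moves c t u; rewrite E mem_head t0 ltn0 => /(_ isT).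
suff indep m t : inversions t <= m -> forall p, inversions t <= p ->
    bipass_rec m t = bipass_rec p t by move=> /indep; apply.
elim: m t => [|m IHm] t; last move=> le_t_m.
  by rewrite leqn0 => /eqP t0 [|p] //= _; rewrite /left_moves /right_moves !moves0.
case=> [|p] le_t_p /=.
  move: le_t_p; rewrite leqn0 => /eqP t0.
  by rewrite /left_moves /right_moves !moves0.
by congr Game; apply/eq_in_map => u /inversions_moves lt_u; apply: IHm; lia.
Qed.

Lemma bipassE (s : seq stone) :
  bipass s = Game (map bipass (left_moves s)) (map bipass (right_moves s)).
Proof.
rewrite -(bipass_rec_fuel (leqnSn (inversions s))) /=.
by congr Game; apply/eq_in_map => u /inversions_moves /ltnW;
  apply: bipass_rec_fuel.
Qed.

(* Main.v *)
Require Import Defs.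
From HB Require Import structures.
From mathcomp Require Import all_boot zify.

Set Implicit Arguments.
Unset Strict Implicit.
Unset Printing Implicit Defensive.

(** Call the number of white stones of a strip minus the number of its black
    stones its balance.  A Left move raises the balance by at most one, and
    moving the last black stone to the end raises it by exactly one, unless
    that stone is the only one of its colour and the strip vanishes;
    symmetrically for Right.  So the balance behaves like an atomic weight,
    and the game is a race.

    The other side of the comparison is put in a form with very few moves.  Let
    [tower 0 = 0] and [tower m.+1 = {tower m | 0}].  Then [tower k.+1] equals
    k copies of down + star, plus star ([tower_copies]), so that part (a) asks
    when the sum of [s] and [tower k.+1] is a win for the second player.  In
    that sum let the lead of Left be the balance of [s] minus [m.-1] when the
    tower is [tower m].  Left can always gain one unit of lead by stepping down
    the tower, or by the strip move above.  Hence whoever is ahead wins moving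
    first, and whoever is ahead by two wins in any case ([left_ahead],
    [right_ahead]); the induction starts from the strips played alone
    ([strip_alone]).

    There remains the case of lead zero.  Write [biblock p q] for the strip
    B W^p B^q W.  At [biblock (n + m) n] plus [tower m.+1] every first move is
    a mistake: if it shifts the lead by one unit in favour of the mover, the
    opponent restores a position of the same family, and otherwise it gives the
    lead away or leaves a single component that the opponent wins
    ([biblock_lose_left], [biblock_lose_right]).  At any other strip
    with lead zero, Left, moving first, wins: she takes one unit of lead while
    keeping outside the family, and Right cannot then reach the family in one
    move, because the only way into it that costs Left one unit of lead starts
    inside the family ([retire_to_biblock], [not_biblock_win]).  The one
    exception is BBWW plus star, where she moves to BWBW plus star.

    Part (b) follows by reversing a strip and exchanging the colours, which
    turns its game into the negative ([wins_bipass_conj]).  The same symmetry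
    gives the Right version of each statement about Left moves. *)

(** * Outcomes of sums of games *)

Definition other (p : player) : player := if p is Left then Right else Left.

Lemma otherK : involutive other. Proof. by case. Qed.

Definition options (p : player) (G : game) : seq game :=
  let: Game GL GR := G in if p is Left then GL else GR.

Lemma hasInP (T : Type) (a : pred T) (s : seq T) :
  has a s <-> exists2 x, List.In x s & a x.
Proof.
elim: s => [|y s IHs] /=; first by split=> // -[].
split=> [/orP[ay|/IHs[x sx ax]]|[x [<-|sx] ax]].
- by exists y => //; left.
- by exists x => //; right.
- by rewrite ax.
- by apply/orP; right; apply/IHs; exists x.
Qed.

Lemma eq_map_In (T U : Type) (f g : T -> U) (s : seq T) :
  (forall x, List.In x s -> f x = g x) -> map f s = map g s.
Proof.
elim: s => //= x s IHs fg; rewrite fg; last by left.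
by rewrite IHs // => y sy; apply: fg; right.
Qed.

(** The induction principle generated for [game] says nothing about the options,
    which are nested in lists. *)
Lemma game_options_ind (P : game -> Prop) :
  (forall G, (forall p G', List.In G' (options p G) -> P G') -> P G) ->
  forall G, P G.
Proof.
move=> IH; fix rec 1; case=> GL GR; apply: IH; case=> G' /=.
  elim: GL => [[]|G1 GL IHL [<-|]]; [exact: rec | exact: IHL].
elim: GR => [[]|G1 GR IHR [<-|]]; [exact: rec | exact: IHR].
Qed.

Lemma wins_firstE (p : player) (G : game) :
  wins_first p G = has (fun G' => ~~ wins_first (other p) G') (options p G).
Proof. by case: G => GL GR; case: p. Qed.

Lemma options_add (p : player) (G H : game) :
  options p (G + H)%game
  = [seq (G' + H)%game | G' <- options p G]
    ++ [seq (G + H')%game | H' <- options p H].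
Proof. by case: G => GL GR; case: H => HL HR; case: p. Qed.

Lemma options_opp (p : player) (G : game) :
  options p (- G)%game = map oppg (options (other p) G).
Proof. by case: G => GL GR; case: p. Qed.

Lemma game_eta (G H : game) :
  (forall p, options p G = options p H) -> G = H.
Proof.
case: G => GL GR; case: H => HL HR eqGH.
by move: (eqGH Left) (eqGH Right) => /= -> ->.
Qed.

Lemma wins_add (p : player) (G H : game) :
  wins_first p (G + H)%game
  = has (fun G' => ~~ wins_first (other p) (G' + H)%game) (options p G)
    || has (fun H' => ~~ wins_first (other p) (G + H')%game) (options p H).
Proof. by rewrite wins_firstE options_add has_cat !has_map. Qed.

Lemma eq_has_In (T : Type) (a b : pred T) (s : seq T) :
  (forall x, List.In x s -> a x = b x) -> has a s = has b s.
Proof.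
elim: s => //= x s IHs ab; rewrite ab; last by left.
by rewrite IHs // => y sy; apply: ab; right.
Qed.

(** The lists of options agree literally, so associativity is an equality of
    trees.  Commutativity holds only up to the order of the options, and is
    stated for outcomes in [wins_addC]. *)
Lemma addgA (G H K : game) : (G + (H + K) = G + H + K)%game.
Proof.
elim/game_options_ind: G H K => G IHG; elim/game_options_ind=> H IHH.
elim/game_options_ind=> K IHK; apply: game_eta => p.
rewrite !options_add !map_cat -!map_comp -catA; congr (_ ++ _ ++ _).
- by apply: eq_map_In => G' GG' /=; apply: IHG GG' _ _.
- by apply: eq_map_In => H' HH' /=; apply: IHH HH' _.
- by apply: eq_map_In => K' KK' /=; apply: IHK KK'.
Qed.

Lemma oppgD (G H : game) : (- (G + H) = - G + - H)%game.
Proof.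
elim/game_options_ind: G H => G IHG; elim/game_options_ind=> H IHH.
apply: game_eta => p.
rewrite options_opp !options_add !options_opp map_cat -!map_comp.
congr (_ ++ _); apply: eq_map_In => K GK /=; first exact: IHG GK _.
exact: IHH GK.
Qed.

Lemma oppgK : involutive oppg.
Proof.
elim/game_options_ind=> G IHG; apply: game_eta => p.
rewrite !options_opp -map_comp otherK -[RHS]map_id.
by apply: eq_map_In => G' /IHG.
Qed.

Lemma wins_opp (p : player) (G : game) :
  wins_first p (- G)%game = wins_first (other p) G.
Proof.
elim/game_options_ind: G p => G IHG p.
rewrite !wins_firstE options_opp has_map; apply: eq_has_In => G' GG' /=.
by rewrite (IHG _ _ GG').
Qed.

Lemma wins_addC (p : player) (G H : game) :
  wins_first p (G + H)%game = wins_first p (H + G)%game.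
Proof.
elim/game_options_ind: G H p => G IHG; elim/game_options_ind=> H IHH p.
rewrite !wins_add orbC; congr (_ || _); apply: eq_has_In => K GK.
  by rewrite (IHH _ _ GK).
by rewrite (IHG _ _ GK).
Qed.

Lemma spwP (G : game) :
  reflect (forall p, ~~ wins_first p G) (second_player_win G).
Proof.
apply: (iffP andP) => [[? ?] []|winG] //.
Qed.

(** The second player copies the move of the first in the other component. *)
Lemma spw_sub (G : game) : second_player_win (G - G)%game.
Proof.
apply/spwP; elim/game_options_ind: G => G IHG p; apply/negP.
rewrite wins_add options_opp has_map => /orP[]; move/hasInP=> [G' GG'] /=.
  case/negP; rewrite wins_add; apply/orP; right.
  rewrite options_opp otherK has_map; apply/hasInP; exists G' => //=.
  exact: IHG GG' _.
case/negP; rewrite wins_add; apply/orP; left; apply/hasInP; exists G' => //.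
by rewrite otherK (IHG _ _ GG').
Qed.

Lemma winsP (p : player) (G : game) :
  wins_first p G <->
  exists2 G', List.In G' (options p G) & ~~ wins_first (other p) G'.
Proof. by rewrite wins_firstE; apply: hasInP. Qed.

Lemma wins_addP (p : player) (G H : game) :
  wins_first p (G + H)%game <->
  (exists2 G', List.In G' (options p G)
               & ~~ wins_first (other p) (G' + H)%game) \/
  (exists2 H', List.In H' (options p H)
               & ~~ wins_first (other p) (G + H')%game).
Proof.
rewrite wins_add; split=> [/orP[]|[]] /hasInP; first by left.
- by right.
- by move=> ->.
- by move=> ->; rewrite orbT.
Qed.

Lemma loses_option (p : player) (G G' : game) :
  ~~ wins_first p G -> List.In G' (options p G) -> wins_first (other p) G'.
Proof.
move=> /negP loseG GG'; apply: contra_notT loseG => ?.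
by apply/winsP; exists G'.
Qed.

(** The second player answers each move in the component where it was made.
    The two winning statements are carried along because an answer is a move by
    the first player in a sum where only one component is won. *)
Lemma lose_win_add (p : player) (G Z : game) :
  [/\ ~~ wins_first p G -> ~~ wins_first p Z -> ~~ wins_first p (G + Z)%game,
      wins_first p G -> ~~ wins_first (other p) Z -> wins_first p (G + Z)%game
    & ~~ wins_first (other p) G -> wins_first p Z ->
      wins_first p (G + Z)%game].
Proof.
elim/game_options_ind: G Z p => G IHG; elim/game_options_ind=> Z IHZ p.
split=> [loseG loseZ|/winsP[G' GG' loseG'] loseZ|loseG /winsP[Z' ZZ' loseZ']].
- apply/negP=> /wins_addP[] [K GK] /negP[].
    by have [_ + _] := IHG _ _ GK Z (other p); rewrite otherK; apply;
      rewrite ?(loses_option loseG GK).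
  by have [_ _ +] := IHZ _ _ GK (other p); rewrite otherK; apply;
    rewrite ?(loses_option loseZ GK).
- apply/wins_addP; left; exists G' => //.
  by have [+ _ _] := IHG _ _ GG' Z (other p); apply.
- apply/wins_addP; right; exists Z' => //.
  by have [+ _ _] := IHZ _ _ ZZ' (other p); apply.
Qed.

Lemma wins_add_zero (p : player) (G Z : game) :
  second_player_win Z -> wins_first p (G + Z)%game = wins_first p G.
Proof.
move=> /spwP zeroZ; have [lose win _] := lose_win_add p G Z.
apply/idP/idP=> [|/win->//]; apply: contraTT => /lose; exact.
Qed.

Lemma spw_opp (G : game) : second_player_win (- G)%game = second_player_win G.
Proof. by rewrite /second_player_win !wins_opp andbC. Qed.

(** Equal games are interchangeable in sums: add the zero game [- Y + Y] and
    regroup, so that [X - Y] can be dropped instead. *)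
Lemma wins_add_eqg (p : player) (G X Y : game) :
  (X ≡ Y)%game -> wins_first p (G + X)%game = wins_first p (G + Y)%game.
Proof.
rewrite /eqg => eqXY.
have zeroY : second_player_win (- Y + Y)%game.
  by rewrite -spw_opp oppgD oppgK spw_sub.
rewrite -(wins_add_zero p (G + X)%game zeroY).
have -> : (G + X + (- Y + Y) = G + (X - Y) + Y)%game by rewrite !addgA.
by rewrite wins_addC addgA wins_add_zero // wins_addC.
Qed.

(** * A canonical form for the right-hand side *)

(** For [m > 0], [tower m] is the canonical form of m - 1 copies of
    down + star, plus star. *)
Definition tower (m : nat) : game :=
  iter m (fun G => Game [:: G] [:: zerog]) zerog.

Definition wins_tower_sum (p : player) (a b c d : nat) : bool :=
  wins_first p (tower a + tower b + tower c - tower d)%game.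

Lemma wins_tower_sum_left (a b c d : nat) :
  wins_tower_sum Left a b c d =
  [|| (0 < a) && ~~ wins_tower_sum Right a.-1 b c d,
      (0 < b) && ~~ wins_tower_sum Right a b.-1 c d,
      (0 < c) && ~~ wins_tower_sum Right a b c.-1 d
    | (0 < d) && ~~ wins_tower_sum Right a b c 0].
Proof.
rewrite /wins_tower_sum wins_add options_opp has_map.
rewrite !options_add !has_cat !has_map !has_cat !has_map.
by case: a b c d => [|a] [|b] [|c] [|d]; rewrite /= ?orbF ?orbA.
Qed.

Lemma wins_tower_sum_right (a b c d : nat) :
  wins_tower_sum Right a b c d =
  [|| (0 < a) && ~~ wins_tower_sum Left 0 b c d,
      (0 < b) && ~~ wins_tower_sum Left a 0 c d,
      (0 < c) && ~~ wins_tower_sum Left a b 0 d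
    | (0 < d) && ~~ wins_tower_sum Left a b c d.-1].
Proof.
rewrite /wins_tower_sum wins_add options_opp has_map.
rewrite !options_add !has_cat !has_map !has_cat !has_map.
by case: a b c d => [|a] [|b] [|c] [|d]; rewrite /= ?orbF ?orbA.
Qed.

(** For [a > 0] the value of [tower a] is a - 1 copies of down plus a copies of
    star.  The sum therefore has value w copies of up plus e copies of star,
    where w is [d.-1] minus [a.-1 + b.-1 + c.-1] and e is the parity of
    [a + b + c + d]; the formula is the known outcome of such a value. *)
Lemma wins_tower_sumE (p : player) (a b c d : nat) :
  wins_tower_sum p a b c d =
  let x := a.-1 + b.-1 + c.-1 in
  if p is Left then
    (x < d.-1) || odd (a + b + c + d) && (x <= d.-1.+1)
  else (d.-1 < x) || odd (a + b + c + d) && (d.-1 <= x.+1).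
Proof.
have [n] := ubnP (a + b + c + d).
elim: n p a b c d => // n IHn p a b c d le_n.
case: p; rewrite (wins_tower_sum_left, wins_tower_sum_right) /=.
  by case: a b c d le_n => [|a] [|b] [|c] [|d] le_n; rewrite /= ?IHn /=; lia.
by case: a b c d le_n => [|a] [|b] [|c] [|d] le_n; rewrite /= ?IHn /=; lia.
Qed.

Lemma opp_copies (k : nat) (G : game) : (- (k ⋅ G) = k ⋅ (- G))%game.
Proof.
have copiesS j H : (j.+1 ⋅ H = H + j ⋅ H)%game by [].
by elim: k => // k IHk; rewrite !copiesS oppgD IHk.
Qed.

Lemma opp_up_copies (k : nat) :
  (- (k ⋅ (up + star) + star) = k ⋅ (down + star) + star)%game.
Proof. by rewrite oppgD opp_copies. Qed.

Lemma tower_copies (k : nat) :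
  (tower k.+1 ≡ k ⋅ (down + star) + star)%game.
Proof.
elim: k => [|k IHk]; first exact: spw_sub.
have zero : second_player_win (down + star + tower k.+1 - tower k.+2)%game.
  apply/spwP=> p.
  (* down and star are themselves towers *)
  rewrite -[down]/(tower 2) -[star]/(tower 1).
  rewrite -/(wins_tower_sum p 2 1 k.+1 k.+2) wins_tower_sumE.
  by case: p; lia.
have -> : (k.+1 ⋅ (down + star) + star =
           (down + star) + (k ⋅ (down + star) + star))%game by rewrite addgA.
rewrite /eqg -spw_opp oppgD oppgK; apply/spwP=> p.
by rewrite addgA -(wins_add_eqg p _ IHk) -addgA wins_addC (spwP _ zero).
Qed.

(** * Colour reversal *)

Definition flip (c : stone) : stone := if c is B then W else B.

Lemma flipK : involutive flip. Proof. by case. Qed.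

Definition conj (s : seq stone) : seq stone := rev (map flip s).

Lemma conj_cat (s t : seq stone) : conj (s ++ t) = conj t ++ conj s.
Proof. by rewrite /conj map_cat rev_cat. Qed.

Lemma conj_cons (c : stone) (s : seq stone) :
  conj (c :: s) = conj s ++ [:: flip c].
Proof. by rewrite -cat1s conj_cat. Qed.

Lemma conj_nseq (n : nat) (c : stone) : conj (nseq n c) = nseq n (flip c).
Proof. by rewrite /conj map_nseq rev_nseq. Qed.

Lemma conjK : involutive conj.
Proof. by move=> s; rewrite /conj map_rev revK (mapK flipK). Qed.

Lemma count_conj (c : stone) (s : seq stone) :
  count_mem c (conj s) = count_mem (flip c) s.
Proof.
by rewrite /conj count_rev count_map; apply: eq_count => d; case: c; case: d.
Qed.

Lemma conj_eq0 (s : seq stone) : (conj s == [::]) = (s == [::]).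
Proof. by rewrite -!size_eq0 size_rev size_map. Qed.

Lemma head_conj (s : seq stone) : head W (conj s) = flip (last B s).
Proof.
by case/lastP: s => // s c; rewrite /conj map_rcons rev_rcons last_rcons.
Qed.

Lemma last_conj (s : seq stone) : last B (conj s) = flip (head W s).
Proof. by rewrite -{2}[s]conjK head_conj flipK. Qed.

Lemma is_strip_conj (s : seq stone) : is_strip (conj s) = is_strip s.
Proof.
rewrite /is_strip conj_eq0 head_conj last_conj andbC.
by case: (head W s); case: (last B s).
Qed.

(** * Dead stones *)

Lemma strip_leading_rcons (c d : stone) (s : seq stone) :
  strip_leading c (rcons s d) =
  if strip_leading c s is e :: t then rcons (e :: t) d
  else if d == c then [::] else [:: d].
Proof. by elim: s => //= e s IHs; case: ifP. Qed.

Definition strip_trailing_black (s : seq stone) : seq stone :=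
  rev (strip_leading B (rev s)).

Lemma strip_trailing_black_cons (c : stone) (s : seq stone) :
  strip_trailing_black (c :: s) =
  if (c == B) && (strip_trailing_black s == [::]) then [::]
  else c :: strip_trailing_black s.
Proof.
rewrite /strip_trailing_black rev_cons strip_leading_rcons.
case: (strip_leading B (rev s)) => [|e t]; last first.
  by rewrite rev_rcons -[rev _ == _]size_eq0 size_rev andbF.
by case: c.
Qed.

(** The two clean-up passes commute, which makes [remove_dead] compatible with
    reversal and colour exchange although its definition treats the ends in a
    fixed order. *)
Lemma strip_ends_comm (s : seq stone) :
  strip_leading W (strip_trailing_black s)
  = strip_trailing_black (strip_leading W s).
Proof.
elim: s => // -[] s IHs; last by rewrite strip_trailing_black_cons.
by rewrite [RHS]strip_trailing_black_cons strip_trailing_black_cons; case: ifP.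
Qed.

Lemma strip_leading_flip (c : stone) (s : seq stone) :
  strip_leading (flip c) (map flip s) = map flip (strip_leading c s).
Proof.
by elim: s => //= d s IHs; rewrite (inj_eq (inv_inj flipK)) IHs; case: ifP.
Qed.

Lemma remove_dead_conj (s : seq stone) :
  remove_dead (conj s) = conj (remove_dead s).
Proof.
rewrite /remove_dead -[LHS]/(strip_trailing_black _) -strip_ends_comm.
rewrite /strip_trailing_black /conj !map_rev !revK.
by rewrite -strip_leading_flip map_rev -strip_leading_flip.
Qed.

Lemma remove_dead_strip (s : seq stone) : is_strip s -> remove_dead s = s.
Proof.
case/orP=> [/eqP->//|]; case: s => [|[] s] //=; case/lastP: s => // s c.
rewrite last_rcons => /eqP ->; rewrite /remove_dead -rcons_cons /=.
by rewrite -rcons_cons rev_rcons /= -rev_rcons revK.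
Qed.

Lemma remove_dead_nseqW (n : nat) (s : seq stone) :
  remove_dead (nseq n W ++ s) = remove_dead s.
Proof. by elim: n. Qed.

Lemma remove_dead_catB (s : seq stone) :
  remove_dead (s ++ [:: B]) = remove_dead s.
Proof.
by apply: (inv_inj conjK); rewrite -!remove_dead_conj conj_cat.
Qed.

(** * Moves *)

Lemma notin_nseq (c : stone) (s : seq stone) :
  (c \notin s) = (s == nseq (size s) (flip c)).
Proof.
elim: s => //= d s IHs; rewrite inE negb_or IHs eqseq_cons.
by case: c {IHs}; case: d.
Qed.

Lemma between_cat (a m b : seq stone) (x y : stone) :
  between (size a) (size a + (size m).+1) (a ++ x :: m ++ y :: b) = m.
Proof.
rewrite /between -addSnnS addKn -[a ++ _]/(a ++ [:: x] ++ m ++ y :: b) catA.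
rewrite drop_size_cat ?size_cat /= ?addn1 //; exact: take_size_cat.
Qed.

Lemma interchange_cat (a m b : seq stone) (x y : stone) :
  Defs.interchange (a ++ x :: m ++ y :: b) (size a) (size a + (size m).+1)
  = a ++ W :: m ++ B :: b.
Proof.
rewrite /Defs.interchange; elim: a => [|c a IHa] /=; last by rewrite IHa.
by congr (_ :: _); elim: m => //= c m ->.
Qed.

(** Positions and tests are replaced by a factorization of the strip: the
    stones jumped over all have the colour [flip c]. *)
Lemma movesP (c : stone) (s t : seq stone) :
  reflect (exists a n b, s = a ++ B :: nseq n (flip c) ++ W :: b /\
             t = remove_dead (a ++ W :: nseq n (flip c) ++ B :: b))
          (t \in moves c s).
Proof.
apply: (iffP mapP) => [[[i j]]|[a [n [b [-> ->]]]]].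
  rewrite mem_filter /= => /andP[/and4P[ltij /eqP si /eqP sj c_m] _] ->.
  have ltjs : j < size s.
    by rewrite ltnNge; apply/negP=> /(nth_default B); rewrite sj.
  have ltis : i < size s := ltn_trans ltij ltjs.
  pose m := between i j s; pose b := drop j.+1 s; pose a := take i s.
  have szi : size a = i by rewrite size_takel // ltnW.
  have szm : size m = j - i.+1.
    by rewrite size_takel // size_drop leq_sub2r // ltnW.
  have def_s : s = a ++ B :: m ++ W :: b.
    rewrite -{1}(cat_take_drop i s) (drop_nth W ltis) si; congr (_ ++ _ :: _).
    rewrite -{1}(cat_take_drop (j - i.+1) (drop i.+1 s)) drop_drop subnK //.
    by rewrite (drop_nth B ltjs) sj.
  have def_m : m = nseq (size m) (flip c) by apply/eqP; rewrite -notin_nseq.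
  exists a, (size m), b; rewrite -def_m; split=> //.
  rewrite [in LHS]def_s -{1}szi; have -> : j = size a + (size m).+1 by lia.
  by rewrite interchange_cat.
set m := nseq n _; exists (size a, size a + (size m).+1) => /=; last first.
  by rewrite interchange_cat.
rewrite mem_filter; apply/andP; split=> /=.
  rewrite /jump between_cat notin_nseq size_nseq eqxx andbT.
  have ltFa : (size a + n.+1 < size a) = false by lia.
  rewrite nth_cat ltnn subnn nth_cat ltFa addKn /= nth_cat size_nseq.
  by rewrite ltnn subnn eqxx andbT; lia.
rewrite allpairs_f // mem_iota size_cat /= size_cat /=; lia.
Qed.

Lemma moves_conj (c : stone) (s t : seq stone) :
  (conj t \in moves (flip c) (conj s)) = (t \in moves c s).
Proof.
have conj_moves d u v : v \in moves d u -> conj v \in moves (flip d) (conj u).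
  case/movesP=> a [n [b [-> ->]]]; apply/movesP; exists (conj b), n, (conj a).
  rewrite -remove_dead_conj !(conj_cat, conj_cons) conj_nseq /= -!catA.
  by split.
apply/idP/idP=> [/conj_moves|/conj_moves//]; by rewrite flipK !conjK.
Qed.

Definition moves_of (p : player) : seq stone -> seq (seq stone) :=
  moves (if p is Left then B else W).

Lemma options_bipass (p : player) (s : seq stone) :
  options p (bipass s) = map bipass (moves_of p s).
Proof. by rewrite bipassE; case: p. Qed.

Lemma moves_of_conj (p : player) (s t : seq stone) :
  (conj t \in moves_of (other p) (conj s)) = (t \in moves_of p s).
Proof. by case: p; [apply: (moves_conj B) | apply: (moves_conj W)]. Qed.

Lemma inversions_moves_of (p : player) (s t : seq stone) :
  t \in moves_of p s -> inversions t < inversions s.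
Proof. exact: inversions_moves. Qed.

Lemma wins_bipass_add (p : player) (s : seq stone) (G : game) :
  wins_first p (bipass s + G)%game
  = has (fun t => ~~ wins_first (other p) (bipass t + G)%game) (moves_of p s)
    || has (fun G' => ~~ wins_first (other p) (bipass s + G')%game)
         (options p G).
Proof.
by rewrite wins_add options_bipass; congr (_ || _); apply: has_map.
Qed.

(** The game of the conjugate strip is the negative of the game of the strip
    up to the order of the options, hence the formulation by outcomes in an
    arbitrary sum. *)
Lemma wins_bipass_conj (p : player) (s : seq stone) (G : game) :
  wins_first p (bipass (conj s) + G)%game
  = wins_first p (- bipass s + G)%game.
Proof.
have [n] := ubnP (inversions s); elim: n s p G => // n IHn s p G le_n.
elim/game_options_ind: G p => G IHG p; rewrite wins_bipass_add wins_add.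
congr (_ || _).
  rewrite options_opp options_bipass -map_comp.
  rewrite (has_map (oppg \o bipass) _ (moves_of (other p) s)).
  apply/hasP/hasP=> -[t st] /=.
    move: st; rewrite -{1}[p]otherK -{1}(conjK t) moves_of_conj => st.
    exists (conj t) => //=.
    by rewrite -IHn ?conjK //; apply: leq_trans (inversions_moves_of st) _.
  exists (conj t); first by rewrite -[p]otherK moves_of_conj.
  by rewrite /= IHn //; apply: leq_trans (inversions_moves_of st) _.
by apply: eq_has_In => H GH; rewrite (IHG _ _ GH).
Qed.

(** A Left move affects the ends of the strip in one of four ways, according
    to whether the moved black stone is the first one (so that the white stones
    it passes die) and whether it goes to the end (so that it dies itself). *)
Variant left_move_spec (s t : seq stone) : Prop :=
  | LeftClears n of s = B :: nseq n.+1 W & t = [::]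
  | LeftAdvances n b of b != [::] & s = B :: nseq n.+1 W ++ b & t = B :: b
  | LeftRetires a n of a != [::] & s = a ++ B :: nseq n.+1 W
      & t = a ++ nseq n.+1 W
  | LeftInner a n b of a != [::] & b != [::] & s = a ++ B :: nseq n.+1 W ++ b
      & t = a ++ nseq n.+1 W ++ B :: b.

Lemma is_strip_cat (a b : seq stone) :
  a != [::] -> b != [::] ->
  is_strip (a ++ b) = (head W a == B) && (last B b == W).
Proof.
case: a => // c a _; case/lastP: b => // b d _.
by rewrite /is_strip /= last_cat !last_rcons.
Qed.

Lemma last_nseqW (c : stone) (n : nat) : last c (nseq n.+1 W) = W.
Proof. by elim: n. Qed.

Lemma left_moveP (s t : seq stone) :
  is_strip s -> t \in left_moves s <-> left_move_spec s t.
Proof.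
have nseqSr n u : nseq n W ++ W :: u = nseq n.+1 W ++ u by elim: n => //= n ->.
move=> strip_s; split=> [/movesP[a [n [b [def_s ->]]]]|].
  rewrite -[W :: _ ++ B :: b]/(nseq n.+1 W ++ B :: b).
  rewrite nseqSr in def_s.
  case: a def_s => [|c a] def_s.
    rewrite remove_dead_nseqW; case: b def_s => [|d b] def_s.
      by apply: (LeftClears (n := n)) => //; rewrite def_s cats0.
    apply: (LeftAdvances (n := n) (b := d :: b)) => //.
    apply: remove_dead_strip; move: strip_s; rewrite def_s.
    by rewrite /is_strip /= last_cat.
  case: b def_s => [|d b] def_s.
    apply: (LeftRetires (a := c :: a) (n := n)) => //.
      by rewrite def_s cats0.
    rewrite catA remove_dead_catB; apply: remove_dead_strip.
    by move: strip_s; rewrite def_s cats0 !is_strip_cat //= !last_nseqW.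
  apply: (LeftInner (a := c :: a) (n := n) (b := d :: b)) => //.
  apply: remove_dead_strip; move: strip_s; rewrite def_s !is_strip_cat //.
  by rewrite !(last_cat, last_cons).
case=> [n|n b b0|a n a0|a n b a0 b0] def_s ->; apply/movesP.
- exists [::], n, [::]; rewrite -[W :: _ ++ [:: B]]/(nseq n.+1 W ++ [:: B]).
  by rewrite remove_dead_nseqW nseqSr cats0.
- exists [::], n, b; rewrite -[W :: _ ++ B :: b]/(nseq n.+1 W ++ B :: b).
  rewrite nseqSr remove_dead_nseqW remove_dead_strip //.
  move: strip_s; rewrite def_s; case: (b) b0 => // d b' _.
  by rewrite /is_strip /= last_cat.
- exists a, n, [::]; rewrite -[W :: _ ++ [:: B]]/(nseq n.+1 W ++ [:: B]).
  rewrite nseqSr cats0; split=> //.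
  rewrite catA remove_dead_catB remove_dead_strip //.
  by move: strip_s; rewrite def_s !is_strip_cat //= !last_nseqW.
exists a, n, b; rewrite -[W :: _ ++ B :: b]/(nseq n.+1 W ++ B :: b).
rewrite nseqSr; split=> //; rewrite remove_dead_strip //.
move: strip_s; rewrite def_s !is_strip_cat //= !last_cat /=.
by case: (b) b0.
Qed.

(** * Left moves and the balance *)

Notation whites s := (count_mem W s).
Notation blacks s := (count_mem B s).

Lemma whites_nseqW n : whites (nseq n W) = n.
Proof. by rewrite count_nseq mul1n. Qed.

Lemma blacks_nseqW n : blacks (nseq n W) = 0.
Proof. by rewrite count_nseq. Qed.

Lemma whites_nseqB n : whites (nseq n B) = 0.
Proof. by rewrite count_nseq. Qed.

Lemma blacks_nseqB n : blacks (nseq n B) = n.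
Proof. by rewrite count_nseq mul1n. Qed.

Lemma count_cons (c d : stone) (s : seq stone) :
  count_mem c (d :: s) = (d == c) + count_mem c s.
Proof. by []. Qed.

Lemma neqBW : ((B == W) = false) * ((W == B) = false). Proof. by []. Qed.

Definition countE :=
  (count_cat, count_cons, @eqxx stone, neqBW, whites_nseqW,
   blacks_nseqW, whites_nseqB, blacks_nseqB, add0n, addn0).

Lemma strip_stones (s : seq stone) :
  is_strip s -> s != [::] -> 0 < blacks s /\ 0 < whites s.
Proof.
case: s => // c s; rewrite /is_strip /= => /andP[/eqP-> last_s] _; split=> //.
case/lastP: s last_s => // s d; rewrite last_rcons -cats1 count_cat => /eqP->.
by rewrite addnS.
Qed.

Lemma left_move_strip (s t : seq stone) :
  is_strip s -> t \in left_moves s -> is_strip t.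
Proof.
move=> strip_s /(left_moveP t strip_s).
case=> [n _ ->|n b b0 def_s ->|a n a0 def_s ->|a n b a0 b0 def_s ->] //;
  move: strip_s; rewrite def_s.
- by case: (b) b0 => // d b' _; rewrite /is_strip /= last_cat.
- by rewrite !is_strip_cat //= last_nseqW.
- rewrite !is_strip_cat //= !last_cat /=.
  by case: (b) b0.
Qed.

Lemma left_move_balance (s t : seq stone) :
  is_strip s -> t \in left_moves s ->
  whites t + blacks s <= (whites s + blacks t).+1.
Proof.
move=> strip_s /(left_moveP t strip_s).
by case=> [n -> ->|n b _ -> ->|a n _ -> ->|a n b _ _ -> ->];
  rewrite ?countE; lia.
Qed.

Lemma left_move_clears (s : seq stone) :
  is_strip s -> [::] \in left_moves s -> blacks s = 1.
Proof.
move=> strip_s /(left_moveP _ strip_s).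
case=> [n -> _|n b|a n a0 _ /(congr1 size)|a n b a0 _ _ /(congr1 size)] //.
- by rewrite !countE.
- by rewrite size_cat /=; lia.
- by rewrite size_cat /=; lia.
Qed.

Lemma last_black (u : seq stone) :
  exists a n, B :: u = a ++ B :: nseq n W.
Proof.
elim/last_ind: u => [|u c [a [n def_u]]]; first by exists [::], 0.
case: c; first by exists (B :: u), 0; rewrite cats1.
exists a, n.+1; rewrite -rcons_cons def_u rcons_cat rcons_cons.
by congr (_ ++ _ :: _); elim: n {def_u} => //= n ->.
Qed.

Lemma strip_last_run (s : seq stone) :
  is_strip s -> s != [::] -> exists a n, s = a ++ B :: nseq n.+1 W.
Proof.
case: s => // c s; rewrite /is_strip /= => /andP[/eqP-> last_s] _.
have [a [[|n] def_s]] := last_black s; last by exists a, n.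
by rewrite -[last B s]/(last B (B :: s)) def_s last_cat in last_s.
Qed.

(** The move is that of the last black stone over the whole last run of white
    stones. *)
Lemma left_retreat (s : seq stone) :
  is_strip s -> s != [::] ->
  [::] \in left_moves s \/
  exists2 t, t \in left_moves s
    & [/\ is_strip t, t != [::], whites t = whites s
        & blacks s = (blacks t).+1].
Proof.
move=> strip_s s0; have [a [n def_s]] := strip_last_run strip_s s0.
have [a0|a0] := eqVneq a [::].
  left; apply/left_moveP => //.
  by apply: (LeftClears (n := n)); rewrite // def_s a0.
right; have st : a ++ nseq n.+1 W \in left_moves s.
  by apply/left_moveP => //; apply: (LeftRetires (a := a) (n := n)).
exists (a ++ nseq n.+1 W) => //; split; first exact: left_move_strip st.
- by rewrite -size_eq0 size_cat /=; lia.
- by rewrite def_s !countE.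
- by rewrite def_s ?countE; lia.
Qed.

(** * Right moves *)

Lemma right_moves_conj (s t : seq stone) :
  (t \in right_moves s) = (conj t \in left_moves (conj s)).
Proof. by rewrite -(moves_of_conj Right). Qed.

Lemma right_move_strip (s t : seq stone) :
  is_strip s -> t \in right_moves s -> is_strip t.
Proof.
rewrite right_moves_conj -is_strip_conj -(is_strip_conj t).
exact: left_move_strip.
Qed.

Lemma right_move_balance (s t : seq stone) :
  is_strip s -> t \in right_moves s ->
  blacks t + whites s <= (blacks s + whites t).+1.
Proof.
rewrite right_moves_conj -is_strip_conj => /left_move_balance st /st.
by rewrite !count_conj.
Qed.

Lemma right_move_clears (s : seq stone) :
  is_strip s -> [::] \in right_moves s -> whites s = 1.
Proof.
rewrite right_moves_conj -is_strip_conj => /left_move_clears st /st.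
by rewrite count_conj.
Qed.

Lemma right_retreat (s : seq stone) :
  is_strip s -> s != [::] ->
  [::] \in right_moves s \/
  exists2 t, t \in right_moves s
    & [/\ is_strip t, t != [::], blacks t = blacks s
        & whites s = (whites t).+1].
Proof.
rewrite -is_strip_conj -conj_eq0 => strip_s s0.
have [st|[t st [strip_t t0 wt bs]]] := left_retreat strip_s s0.
  by left; rewrite right_moves_conj.
right; exists (conj t); first by rewrite right_moves_conj conjK.
move: wt bs; rewrite -[blacks s](count_conj W) -[whites s](count_conj B).
by rewrite is_strip_conj conj_eq0 !count_conj; split.
Qed.

(** * The race between a strip and a tower *)

Definition win (p : player) (s : seq stone) (m : nat) : bool :=
  wins_first p (bipass s + tower m)%game.

Lemma win_leftE (s : seq stone) (m : nat) :
  win Left s m = has (fun t => ~~ win Right t m) (left_moves s)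
                 || (0 < m) && ~~ win Right s m.-1.
Proof.
by rewrite /win wins_bipass_add; congr (_ || _); case: m => //= m; rewrite orbF.
Qed.

Lemma win_rightE (s : seq stone) (m : nat) :
  win Right s m = has (fun t => ~~ win Left t m) (right_moves s)
                  || (0 < m) && ~~ win Left s 0.
Proof.
by rewrite /win wins_bipass_add; congr (_ || _); case: m => //= m; rewrite orbF.
Qed.

Lemma win_left_move (s t : seq stone) (m : nat) :
  t \in left_moves s -> ~~ win Right t m -> win Left s m.
Proof.
by move=> st wt; rewrite win_leftE; apply/orP; left; apply/hasP; exists t.
Qed.

Lemma win_right_move (s t : seq stone) (m : nat) :
  t \in right_moves s -> ~~ win Left t m -> win Right s m.
Proof.
by move=> st wt; rewrite win_rightE; apply/orP; left; apply/hasP; exists t.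
Qed.

Lemma win_left_tower (s : seq stone) (m : nat) :
  ~~ win Right s m -> win Left s m.+1.
Proof. by rewrite win_leftE => -> ; rewrite orbT. Qed.

Lemma win_right_tower (s : seq stone) (m : nat) :
  ~~ win Left s 0 -> win Right s m.+1.
Proof. by rewrite win_rightE => -> ; rewrite orbT. Qed.

Lemma lose_left (s : seq stone) (m : nat) :
  (forall t, t \in left_moves s -> win Right t m) ->
  (0 < m -> win Right s m.-1) -> ~~ win Left s m.
Proof.
move=> ws wm; rewrite win_leftE negb_or; apply/andP; split.
  by apply/hasPn=> t /ws ->.
by case: m wm {ws} => //= m ->.
Qed.

Lemma lose_right (s : seq stone) (m : nat) :
  (forall t, t \in right_moves s -> win Left t m) ->
  (0 < m -> win Left s 0) -> ~~ win Right s m.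
Proof.
move=> ws wm; rewrite win_rightE negb_or; apply/andP; split.
  by apply/hasPn=> t /ws ->.
by case: m wm {ws} => //= m ->.
Qed.

Lemma win_conj0 (p : player) (s : seq stone) :
  win p (conj s) 0 = win (other p) s 0.
Proof.
rewrite /win wins_bipass_conj.
by rewrite -[tower 0 in LHS]/(- zerog)%game -oppgD wins_opp.
Qed.

(** Left raises the balance by one unit and Right cannot bring it below zero
    with the next move; when the strip has a single black stone, Left clears it
    and wins at once. *)
Lemma strip_alone (s : seq stone) :
  is_strip s -> s != [::] ->
  (blacks s <= whites s -> win Left s 0) /\
  (blacks s < whites s -> ~~ win Right s 0).
Proof.
have [n] := ubnP (inversions s); elim: n s => // n IHn s le_n strip_s s0.
split=> bal.
  have [st|[t st [strip_t t0 wt bs]]] := left_retreat strip_s s0.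
    exact: win_left_move st _.
  apply: (win_left_move st).
  have lt_t := @inversions_moves_of Left _ _ st.
  by case: (IHn t _ strip_t t0) => [|_]; [lia | apply; lia].
apply: lose_right => // t st.
have lt_t := @inversions_moves_of Right _ _ st.
have strip_t := right_move_strip strip_s st.
have t0 : t != [::].
  apply/eqP=> t0; move: st; rewrite t0 => /(right_move_clears strip_s).
  by have [] := strip_stones strip_s s0; lia.
have := right_move_balance strip_s st.
by case: (IHn t _ strip_t t0) => [|+ _ ?]; [lia | apply; lia].
Qed.

Lemma win_left_alone (s : seq stone) :
  is_strip s -> s != [::] -> blacks s <= whites s -> win Left s 0.
Proof. by move=> strip_s s0; case: (strip_alone strip_s s0). Qed.

Lemma win_right_alone (s : seq stone) :
  is_strip s -> s != [::] -> whites s <= blacks s -> win Right s 0.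
Proof.
rewrite -(win_conj0 Left) -is_strip_conj -conj_eq0 => ? ? ?.
by apply: win_left_alone; rewrite // !count_conj.
Qed.

Lemma lose_right_alone (s : seq stone) :
  is_strip s -> blacks s < whites s -> ~~ win Right s 0.
Proof.
move=> strip_s bal; have s0 : s != [::] by case: (s) bal.
by case: (strip_alone strip_s s0) => _; apply.
Qed.

Lemma lose_left_alone (s : seq stone) :
  is_strip s -> whites s < blacks s -> ~~ win Left s 0.
Proof.
rewrite -(win_conj0 Right) -is_strip_conj => ? ?.
by apply: lose_right_alone; rewrite // !count_conj.
Qed.

(** Left steps down the tower, which gains one unit, and any move of Right loses
    at most one unit for Left.  At [m = 1] the step leaves the strip alone with
    positive balance. *)
Lemma left_ahead (s : seq stone) (m : nat) :
  is_strip s ->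
  (blacks s + m.-1 < whites s -> win Left s m) /\
  (blacks s + m.-1 + 1 < whites s -> ~~ win Right s m).
Proof.
have [n] := ubnP (inversions s + m); elim: n s m => // n IHn s m le_n strip_s.
case: m le_n => [|m] le_n.
  split=> bal; last by apply: lose_right_alone => //; lia.
  by apply: win_left_alone; [|case: (s) bal|lia].
split=> bal.
  apply: win_left_tower; case: m le_n bal => [|m] le_n bal.
    by apply: lose_right_alone => //; lia.
  by case: (IHn s m.+1 _ strip_s) => [|_]; [lia | apply; lia].
apply: lose_right => [t st|_]; last first.
  by apply: win_left_alone; [|case: (s) bal|lia].
have lt_t := @inversions_moves_of Right _ _ st.
have bal_t := right_move_balance strip_s st.
case: (IHn t m.+1 _ (right_move_strip strip_s st)) => [|+ _]; first lia.
by apply; lia.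
Qed.

Lemma lose_left_empty (m : nat) : m != 1 -> ~~ win Left [::] m.
Proof.
by case: m => [|[|m]] // _; apply: lose_left => // _; apply: win_right_tower.
Qed.

(** The mirror image of [left_ahead], except that Right cannot step down the
    tower by one unit: either he deletes it, or he lowers the balance of the
    strip. *)
Lemma right_ahead (s : seq stone) (m : nat) :
  is_strip s ->
  (whites s < blacks s + m.-1 -> win Right s m) /\
  (whites s + 1 < blacks s + m.-1 -> ~~ win Left s m).
Proof.
have [n] := ubnP (inversions s + m); elim: n s m => // n IHn s m le_n strip_s.
case: m le_n => [|m] le_n.
  split=> bal; last by apply: lose_left_alone => //; lia.
  by apply: win_right_alone; [|case: (s) bal|lia].
split=> bal.
  have [s0|s0] := eqVneq s [::]; first by rewrite s0; apply: win_right_tower.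
  have [bal0|bal0] := ltnP (whites s) (blacks s).
    by apply: win_right_tower; apply: lose_left_alone.
  have [st|[t st [strip_t t0 bt ws]]] := right_retreat strip_s s0.
    apply: (win_right_move st); apply: lose_left_empty.
    have := right_move_clears strip_s st.
    by have [] := strip_stones strip_s s0; lia.
  apply: (win_right_move st).
  have lt_t := @inversions_moves_of Right _ _ st.
  by case: (IHn t m.+1 _ strip_t) => [|_]; [lia | apply; lia].
apply: lose_left => [t st|_].
  have lt_t := @inversions_moves_of Left _ _ st.
  have bal_t := left_move_balance strip_s st.
  case: (IHn t m.+1 _ (left_move_strip strip_s st)) => [|+ _]; first lia.
  by apply; lia.
by case: (IHn s m _ strip_s) => [|+ _]; [lia | apply; lia].
Qed.

(** * The strips B W^p B^q W *)

Definition biblock (p q : nat) : seq stone :=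
  [:: B] ++ nseq p W ++ nseq q B ++ [:: W].

Lemma is_strip_biblock p q : is_strip (biblock p q).
Proof. by rewrite /is_strip /= !last_cat. Qed.

Lemma whites_biblock p q : whites (biblock p q) = p.+1.
Proof. by rewrite !countE; lia. Qed.

Lemma blacks_biblock p q : blacks (biblock p q) = q.+1.
Proof. by rewrite !countE; lia. Qed.

Lemma conj_biblock p q : conj (biblock p q) = biblock q p.
Proof. by rewrite /biblock !conj_cat !conj_nseq /= -!catA. Qed.

(** Only the first and the last black stone of [biblock p q] can stand directly
    before a white stone, and the last one is followed by a single one. *)
Lemma last_run_biblock (a r : seq stone) (p q : nat) :
  a ++ B :: W :: r = nseq p W ++ nseq q B ++ [:: W] ->
  r = [::] /\ exists2 q', q = q'.+1 & a = nseq p W ++ nseq q' B.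
Proof.
elim: p a => [|p IHp] a /=; last first.
  by case: a => // c a [-> /IHp[-> [q' -> ->]]]; split=> //; exists q'.
elim: q a => [|q IHq] [|c a] //=; first by case: a.
  by case: q {IHq} => // -[->]; split=> //; exists 0.
by case=> -> /IHq[-> [q' -> ->]]; split=> //; exists q'.+1.
Qed.

Lemma left_move_biblock (p q : nat) (t : seq stone) :
  t \in left_moves (biblock p q) ->
  [\/ t = [::], whites t + q < p + blacks t
    | exists2 q', q = q'.+1 & t = biblock p q'].
Proof.
move/(left_moveP _ (is_strip_biblock p q)).
case=> [n _ ->|n b b0 def_s ->|a n a0 def_s ->|a n b a0 b0 def_s ->].
- by constructor 1.
- constructor 2; have := congr1 (count_mem W) def_s.
  have := congr1 (count_mem B) def_s.
  by rewrite whites_biblock blacks_biblock !countE; lia.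
- constructor 3; case: a a0 def_s => // c a _ [<-] /esym.
  move=> /last_run_biblock[n0 [q' -> ->]]; exists q' => //.
  by case: n n0 => //= _; rewrite -catA.
case: a a0 def_s => // c a _ [<-] /esym /last_run_biblock[].
by move/(congr1 size); rewrite size_cat size_nseq; case: (b) b0 => //=; lia.
Qed.

Lemma right_move_biblock (p q : nat) (t : seq stone) :
  t \in right_moves (biblock p q) ->
  [\/ t = [::], blacks t + p < q + whites t
    | exists2 p', p = p'.+1 & t = biblock p' q].
Proof.
rewrite right_moves_conj conj_biblock => /left_move_biblock.
rewrite !count_conj => -[/eqP|lt|[p' -> def_t]].
- by rewrite conj_eq0 => /eqP ->; constructor 1.
- by constructor 2.
by constructor 3; exists p' => //; rewrite -[t]conjK def_t conj_biblock.
Qed.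

Lemma biblock_left_move (p q : nat) :
  biblock p q \in left_moves (biblock p q.+1).
Proof.
apply/left_moveP; first exact: is_strip_biblock.
apply: (LeftRetires (a := B :: nseq p W ++ nseq q B) (n := 0)) => //=.
  rewrite /biblock /= -catA; congr (_ :: _ ++ _).
  by elim: q => //= q <-.
by rewrite -catA.
Qed.

Lemma biblock_right_move (p q : nat) :
  biblock p q \in right_moves (biblock p.+1 q).
Proof. by rewrite right_moves_conj !conj_biblock biblock_left_move. Qed.

(** A Left move that neither clears the strip nor lowers the lead moves the
    last black stone to the end or steps down the tower.  Right answers by
    moving the first white stone to the front, which decreases [n + m], or, if
    star was stepped down to zero, wins the strip alone. *)
Lemma biblock_lose_left (n m : nat) : ~~ win Left (biblock (n + m) n) m.+1.
Proof.
have [N] := ubnP (n + m); elim: N n m => // N IHN n m le_N.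
apply: lose_left => [t st|_].
  have strip_t := left_move_strip (is_strip_biblock _ _) st.
  case: (left_move_biblock st) => [->|lt_t|[n' def_n ->]].
  - exact: win_right_tower.
  - by case: (right_ahead m.+1 strip_t) => + _; apply; lia.
  rewrite def_n addSn in le_N *.
  apply: (win_right_move (biblock_right_move _ _)).
  by apply: IHN; lia.
case: m le_N => [|m] le_N; rewrite -pred_Sn.
  apply: win_right_alone; rewrite ?is_strip_biblock //.
  by rewrite whites_biblock blacks_biblock; lia.
rewrite addnS in le_N *; apply: (win_right_move (biblock_right_move _ _)).
by apply: IHN; lia.
Qed.

(** If Right deletes the tower, Left wins the strip alone.  A strip move of
    Right that neither clears the strip nor gives Left the lead moves the first
    white stone to the front.  Left answers by stepping down the tower or, when
    the tower is star, by moving the last black stone to the end. *)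
Lemma biblock_lose_right (n m : nat) : ~~ win Right (biblock (n + m) n) m.+1.
Proof.
have [N] := ubnP (n + m); elim: N n m => // N IHN n m le_N.
apply: lose_right => [t st|_]; last first.
  apply: win_left_alone; rewrite ?is_strip_biblock //.
  by rewrite whites_biblock blacks_biblock; lia.
have strip_t := right_move_strip (is_strip_biblock _ _) st.
case: (right_move_biblock st) => [def_t|lt_t|[p def_p def_t]].
- move: st; rewrite def_t => /(right_move_clears (is_strip_biblock _ _)).
  by rewrite whites_biblock => -[/eqP]; rewrite addn_eq0 => /andP[_ /eqP->].
- by case: (left_ahead m.+1 strip_t) => + _; apply; lia.
case: m le_N def_p {st} => [|m] le_N def_p.
  move: def_p; rewrite addn0 => def_n; rewrite def_t def_n.
  apply: (win_left_move (biblock_left_move _ _)); rewrite -{1}[p]addn0.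
  by apply: IHN; lia.
have {}def_p : p = n + m by lia.
by rewrite def_t def_p; apply: win_left_tower; apply: IHN; lia.
Qed.

(** A Left move of the last black stone to the end that produces a
    [biblock p q] comes from [biblock p q.+1].  The side condition excludes the
    strips B W^p.+1, which also arise from B W^i B W^j with [j > 1]. *)
Lemma retire_to_biblock (a : seq stone) (k p q : nat) :
  (q = 0 -> p = 0) -> a ++ nseq k.+1 W = biblock p q ->
  a ++ B :: nseq k.+1 W = biblock p q.+1.
Proof.
have nseq_rcons n c : nseq n.+1 c = rcons (nseq n c) c by elim: n => //= n <-.
move=> pq0.
have -> : biblock p q = rcons (B :: nseq p W ++ nseq q B) W.
  by rewrite -cats1 /biblock /= -catA.
rewrite nseq_rcons -rcons_cat => /rcons_inj[].
case: k => [|k] def_a.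
  rewrite cats0 in def_a; rewrite def_a /biblock nseq_rcons /= -!catA.
  by rewrite -cats1 -!catA.
have := congr1 (last B) def_a; rewrite nseq_rcons last_cat last_rcons.
case: q pq0 def_a => [/(_ erefl) -> //|q _ _].
by rewrite nseq_rcons -rcons_cat -rcons_cons last_rcons.
Qed.

Lemma right_move_to_biblock (s : seq stone) (p q : nat) :
  is_strip s -> (p = 0 -> q = 0) -> biblock p q \in right_moves s ->
  (p + blacks s).+1 = whites s + q -> s = biblock p.+1 q.
Proof.
rewrite right_moves_conj conj_biblock -is_strip_conj => strip_s qp0.
rewrite -[blacks s](count_conj W) -[whites s](count_conj B) => st bal.
apply: (inv_inj conjK); rewrite conj_biblock; have := whites_biblock q p.
have := blacks_biblock q p; move: st bal.
case/(left_moveP _ strip_s)=>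
  [n _ //|n b _ -> ->|a n a0 -> def_t _ _ _|a n b _ _ -> ->].
- by rewrite !countE; lia.
- by rewrite (retire_to_biblock qp0).
- by rewrite !countE; lia.
Qed.

Lemma biblock_blacks_eq (s : seq stone) (n p : nat) :
  s = biblock p n -> n = (blacks s).-1.
Proof. by move=> ->; rewrite blacks_biblock. Qed.

(** Outside the family, Left is as strong as the lead suggests: a lead of one
    suffices even when Right moves first, and a lead of zero when Left moves
    first.  The two claims feed each other in the induction. *)
Lemma not_biblock_win (s : seq stone) (m : nat) :
  is_strip s ->
  (whites s = (blacks s + m).+1 ->
     (forall n, s <> biblock (n + m.+1) n) -> ~~ win Right s m.+1) /\
  (whites s = blacks s + m ->
     (forall n, s <> biblock (n + m) n) -> win Left s m.+1).
Proof.
have [N] := ubnP (inversions s + m); elim: N s m => // N IHN s m le_N strip_s.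
split=> bal not_s.
  apply: lose_right => [t st|_]; last first.
    by apply: win_left_alone; [|case: (s) bal|lia].
  have lt_t := @inversions_moves_of Right _ _ st.
  have strip_t := right_move_strip strip_s st.
  have bal_t := right_move_balance strip_s st.
  have [lt_bal|ge_bal] := ltnP (blacks t + m) (whites t).
    by case: (left_ahead m.+1 strip_t) => + _; apply; lia.
  case: (IHN t m _ strip_t) => [|_]; first lia.
  apply; first lia.
  move=> n def_t; apply: (not_s n); rewrite addnS.
  rewrite def_t whites_biblock blacks_biblock in bal_t ge_bal.
  by apply: right_move_to_biblock; rewrite -?def_t //; lia.
case: m le_N bal not_s => [|m] le_N bal not_s; last first.
  apply: win_left_tower; case: (IHN s m _ strip_s) => [|+ _]; first lia.
  by apply; [lia | exact: not_s].
have [-> //|s0] := eqVneq s [::].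
(* The tower is star: Left must gain her unit of lead in the strip. *)
have [a [n def_s]] := strip_last_run strip_s s0.
have a0 : a != [::].
  apply/eqP=> a0; apply: (not_s 0); rewrite def_s a0.
  move: bal; rewrite def_s a0 !countE; case: n {def_s} => //=; lia.
have st : a ++ nseq n.+1 W \in left_moves s.
  by apply/left_moveP => //; apply: (LeftRetires (a := a) (n := n)).
have lt_t := @inversions_moves_of Left _ _ st.
have strip_t := left_move_strip strip_s st.
have [def_t|not_t] := eqVneq (a ++ nseq n.+1 W)
    (biblock (blacks (a ++ nseq n.+1 W)).-1.+1 (blacks (a ++ nseq n.+1 W)).-1).
  move: def_t; case: (_.-1) => [|q] def_t; last first.
    case: (not_s q.+2); rewrite def_s addn0.
    by rewrite (retire_to_biblock _ def_t).
  have [n0|n0] := eqVneq n 0.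
    case: (not_s 1); rewrite def_s n0; rewrite n0 in def_t.
    move: def_t; rewrite cats1 -[biblock 1 0]/(rcons [:: B; W] W).
    by case/rcons_inj => ->.
  (* The result is BWW, which Right would answer by BW. *)
  have def_s' : s = [:: B; B; W; W].
    have size_a := congr1 size def_t; rewrite size_cat size_nseq /= in size_a.
    have n1 : n = 1 by case: (a) a0 size_a => //= c a' _; lia.
    rewrite def_s n1; rewrite n1 in def_t size_a.
    case: a def_t size_a {def_s a0 st strip_t lt_t} => [|c [|d a]] /=;
      by [lia | case=> ->].
  rewrite def_s'; apply: (@win_left_move _ (biblock 1 1)).
    by [].
  exact: (biblock_lose_right 1 0).
apply: (win_left_move st).
case: (IHN _ 0 _ strip_t) => [|+ _]; first lia.
apply.
  by move: bal; rewrite def_s !countE; lia.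
move=> k def_t; case/eqP: not_t.
by rewrite {1}def_t -(biblock_blacks_eq def_t) addn1.
Qed.

Lemma spw_strip_tower (s : seq stone) (k : nat) :
  is_strip s ->
  second_player_win (bipass s + tower k.+1)%game <->
  exists n, s = biblock (n + k) n.
Proof.
move=> strip_s; split=> [|[n ->]]; last first.
  by rewrite /second_player_win; apply/andP; split;
    [apply: biblock_lose_left | apply: biblock_lose_right].
case/andP; rewrite -/(win Left s k.+1) -/(win Right s k.+1) => loseL loseR.
have [lt_bal|le_bal] := ltnP (blacks s + k) (whites s).
  by case/negP: loseL; case: (left_ahead k.+1 strip_s) => + _; apply.
have [lt_bal|ge_bal] := ltnP (whites s) (blacks s + k).
  by case/negP: loseR; case: (right_ahead k.+1 strip_s) => + _; apply.
exists (blacks s).-1; apply/eqP; apply: contraNT loseL => not_s.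
case: (not_biblock_win k strip_s) => _; apply; first lia.
by move=> n def_s; case/eqP: not_s; rewrite -(biblock_blacks_eq def_s).
Qed.

Lemma eqg_strip_copies (s : seq stone) (k : nat) :
  is_strip s ->
  (bipass s ≡ k ⋅ (up + star) + star)%game <->
  exists n, s = biblock (n + k) n.
Proof.
move=> strip_s; rewrite -(spw_strip_tower k strip_s).
rewrite /eqg opp_up_copies /second_player_win.
by rewrite -!(wins_add_eqg _ _ (tower_copies k)).
Qed.

Theorem theorem7 (s : seq stone) (k : nat) (hs : is_strip s) :
  ((bipass s ≡ k ⋅ (up + star) + star)%game <->
     exists n : nat, s = [:: B] ++ nseq (n + k) W ++ nseq n B ++ [:: W])
  /\
  ((bipass s ≡ k ⋅ (down + star) + star)%game <->
     exists n : nat, s = [:: B] ++ nseq n W ++ nseq (n + k) B ++ [:: W]).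
Proof.
split; first exact: eqg_strip_copies.
have strip_s' : is_strip (conj s) by rewrite is_strip_conj.
have -> : (bipass s ≡ k ⋅ (down + star) + star)%game
          = (bipass (conj s) ≡ k ⋅ (up + star) + star)%game.
  rewrite /eqg -spw_opp oppgD oppgK opp_up_copies /second_player_win.
  by rewrite !wins_bipass_conj.
rewrite (eqg_strip_copies k strip_s'); split=> -[n def_s]; exists n.
  by rewrite -[LHS]conjK def_s conj_biblock.
by rewrite def_s -[X in conj X]/(biblock _ _) conj_biblock.
Qed.
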